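(* Let $L\ge 0$ and $k>0$ be integers. Put $$A=(L \bmod 2)+((k+1)\bmod 2),\qquad m=L+3-(k \bmod 2),\qquad n=\left\lfloor \frac{k+1}{2}\right\rfloor .$$ Then, expressed in the variable $y=N(N+L+1)$, the hypersum polynomial $S_k^{(L)}$ is given by $$S^{(L)}_{k}(y)=\frac{k!}{(L+k+1)!}\;\frac{\left(\sqrt{4y+(L+1)^2}\right)^{A}}{2^{k-1}\,\bigl(1+(L\bmod 2)\bigr)}\;\prod_{q=0}^{\lfloor L/2\rfloor}\bigl[\,y+q(L+1-q)\,\bigr]$$ $$\qquad\times\det\left\{\bigl[I-(4y+(L+1)^2)J\bigr]\prod_{q=0}^{\lfloor L/2\rfloor}\bigl[I-(L+1-2q)^2J\bigr]\;D_mP^{L+1}D_m^{-1}-K_0+K_{n-1}\right\}_{(n)} .$$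
   Context: Hypersums: for a nonnegative integer $k$ and positive integer $N$, $S_k^{(0)}(N)=\sum_{j=1}^N j^k$ and $S_k^{(L)}(N)=\sum_{j=1}^N S_k^{(L-1)}(j)$ for $L\ge1$. For fixed $L,k$, $S_k^{(L)}(N)$ agrees for all positive integers $N$ with a unique polynomial in $N$, also denoted $S_k^{(L)}$. $S_k^{(L)}(y)$ denotes this polynomial rewritten in terms of $y=N(N+L+1)$, where $\sqrt{4y+(L+1)^2}$ stands for $2N+L+1$ (note $(2N+L+1)^2=4y+(L+1)^2$). Matrices: the following are infinite lower-triangular matrices with rows and columns indexed by $1,2,3,\dots$. $I$ is the identity; $J$ is the lower shift matrix, $J_{ij}=1$ if $i-j=1$ and $0$ otherwise; $P=\sum_{q=0}^\infty \frac{J^q}{(2q+1)!}$; for an integer $m\ge0$, $D_m=\mathrm{diag}(m!,(m+2)!,(m+4)!,\dots)$. $\det\{\cdots\}_{(n)}$ means the determinant of the $n\times n$ matrix obtained by replacing each infinite matrix inside the braces by its $n\times n$ truncation (its first $n$ rows and columns). For $0\le q\le n-1$, $K_q$ inside $\{\cdots\}_{(n)}$ is the $n\times n$ matrix whose only nonzero entry is a $1$ in position $(n-q,n)$. $a \bmod 2\in\{0,1\}$ is the remainder of $a$ on division by $2$. *)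

(* Defs.v *)
From HB Require Import structures.
From mathcomp Require Import all_boot all_order all_algebra.
From mathcomp Require Import ring.

Set Implicit Arguments.
Unset Strict Implicit.
Unset Printing Implicit Defensive.

Import Order.TTheory GRing.Theory Num.Theory.
Local Open Scope ring_scope.

Fixpoint hypersum (L k N : nat) : nat :=
  match L with
  | 0 => (\sum_(1 <= j < N.+1) j ^ k)%N
  | L'.+1 => (\sum_(1 <= j < N.+1) hypersum L' k j)%N
  end.

Definition interpolates_hypersum (L k : nat) (p : {poly rat}) : Prop :=
  forall N : nat, (0 < N)%N -> p.[N%:R] = (hypersum L k N)%:R.

Lemma power_sum_poly_sig (k : nat) :
  {p : {poly rat} | forall N : nat,
     p.[N%:R] = \sum_(1 <= j < N.+1) (j%:R : rat) ^+ k}.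
Proof.
elim/ltn_ind: k => k IH.
pose r := \sum_(i < k) ('C(k.+1, i))%:R *: sval (IH i (ltn_ord i)).
exists (k.+1%:R^-1 *: (('X + 1) ^+ k.+1 - 1 - r)) => N.
have rE M : r.[M%:R] =
    \sum_(1 <= j < M.+1) \sum_(i < k) ('C(k.+1, i))%:R * (j%:R : rat) ^+ i.
  rewrite exchange_big horner_sum /=; apply: eq_bigr => i _.
  by rewrite hornerZ (svalP (IH i (ltn_ord i))) mulr_sumr.
have k0 : (k.+1%:R : rat) != 0 by rewrite pnatr_eq0.
apply: (mulfI k0); rewrite hornerZ mulrA divff // mul1r !hornerE rE.
have binom (x : rat) : (x + 1) ^+ k.+1 =
    \sum_(i < k) ('C(k.+1, i))%:R * x ^+ i + k.+1%:R * x ^+ k + x ^+ k.+1.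
  rewrite addrC exprDn !big_ord_recr subnn !expr1n !mul1r binn binSn mulr1n.
  rewrite -mulr_natl; congr (_ + _ + _).
  by apply: eq_bigr => i _; rewrite expr1n mul1r mulr_natl.
rewrite natr1; elim: N => [|N IHN].
  by rewrite !big_geq // mulr0 expr1n subr0 subrr.
rewrite !(big_nat_recr N.+1) // mulrDr -IHN -(natr1 N.+1) binom.
move: (N.+1%:R : rat) (k.+1%:R : rat) => x c.
rewrite /=; set a := \sum_(i < k) _; set b := bigop _ _ _; set d := x ^+ k.+1.
by move: a b d (x ^+ k) => a b d e; ring.
Qed.

Lemma sum_poly_sig (p : {poly rat}) :
  {q : {poly rat} | forall N : nat,
     q.[N%:R] = \sum_(1 <= j < N.+1) p.[j%:R]}.
Proof.
exists (\sum_(i < size p) p`_i *: sval (power_sum_poly_sig i)) => N.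
under [RHS]eq_bigr do rewrite horner_coef.
rewrite exchange_big horner_sum /=; apply: eq_bigr => i _.
by rewrite hornerZ (svalP (power_sum_poly_sig i)) mulr_sumr.
Qed.

Lemma hypersum_poly_sig (L k : nat) :
  {p : {poly rat} | interpolates_hypersum L k p}.
Proof.
elim: L => [|L [p pP]].
  have [p pP] := power_sum_poly_sig k; exists p => N _.
  by rewrite pP /= natr_sum; apply: eq_bigr => j _; rewrite natrX.
have [q qP] := sum_poly_sig p; exists q => N _.
rewrite qP /= natr_sum big_nat_cond [RHS]big_nat_cond.
by apply: eq_bigr => j /andP[/andP[j1 _] _]; rewrite pP.
Qed.

Definition hypersum_poly (L k : nat) : {poly rat} :=
  sval (hypersum_poly_sig L k).

Lemma hypersum_polyP (L k : nat) : interpolates_hypersum L k (hypersum_poly L k).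
Proof. exact: svalP (hypersum_poly_sig L k). Qed.

Lemma hypersum_poly_unique (L k : nat) (p : {poly rat}) :
  interpolates_hypersum L k p -> p = hypersum_poly L k.
Proof.
move=> pP; apply/eqP; rewrite -subr_eq0; set d := _ - _.
apply/negPn/negP => d0.
pose s : seq rat := [seq (i.+1)%:R | i <- iota 0 (size d)].
have sd : all (root d) s.
  apply/allP => _ /mapP[i _ ->].
  by rewrite /root /d !hornerE pP // hypersum_polyP // subrr.
have us : uniq s.
  rewrite map_inj_uniq ?iota_uniq // => i j /eqP.
  by rewrite eqr_nat eqSS => /eqP.
by have := max_poly_roots d0 sd us; rewrite size_map size_iota ltnn.
Qed.

(* With N := 'X, rewriting a polynomial in terms of y = N(N+L+1) and
   sqrt(4y+(L+1)^2) = 2N+L+1 is an identity in Q[N] between the polynomial and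
   the expression in ysub L and sqrtsub L. *)
Definition ysub (L : nat) : {poly rat} := 'X * ('X + (L + 1)%:R).
Definition sqrtsub (L : nat) : {poly rat} := 2 * 'X + (L + 1)%:R.

Lemma sqrtsub_sqr (L : nat) :
  sqrtsub L ^+ 2 = 4 * ysub L + (L + 1)%:R ^+ 2.
Proof. by rewrite /sqrtsub /ysub; ring. Qed.

(* Jmx, Pmx, Dmx are the n x n truncations of infinite lower-triangular
   matrices; taking truncations commutes with products of such matrices. *)

Definition Jmx (n : nat) : 'M[{poly rat}]_n :=
  \matrix_(i, j) (i == j.+1 :> nat)%:R.

(* The terms q >= n of the infinite sum vanish on the n x n truncation. *)
Definition Pmx (n : nat) : 'M[{poly rat}]_n :=
  \sum_(q < n) (((2 * q + 1)`!%:R)^-1)%:P *: Jmx n ^+ q.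

Definition Dmx (m n : nat) : 'M[{poly rat}]_n :=
  diag_mx (\row_i ((m + 2 * i)`!)%:R).

(* Entry (n-q, n) in 1-based indexing. *)
Definition Kmx (n q : nat) : 'M[{poly rat}]_n :=
  \matrix_(i, j) ((i.+1 == n - q)%N && (j.+1 == n))%:R.

Lemma Jmx_expE (n q : nat) (i j : 'I_n) :
  (Jmx n ^+ q) i j = (i == j + q :> nat)%N%:R.
Proof.
elim: q i j => [|q IH] i j; first by rewrite expr0 mxE addn0.
rewrite exprS mxE.
under eq_bigr do rewrite IH mxE -natrM mulnb.
case: (altP (i =P (j + q.+1)%N :> nat)) => [ij|ij].
  have lt : (j + q < n)%N by rewrite (leq_trans _ (ltn_ord i)) // ij addnS.
  rewrite (bigD1 (Ordinal lt)) //= ij addnS !eqxx big1 ?addr0 // => l.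
  by rewrite -val_eqE /= => /negbTE ->; rewrite andbF.
rewrite big1 // => l _; case: eqP => //= il; case: eqP => //= lj.
by case/eqP: ij; rewrite il lj addnS.
Qed.

Lemma PmxE (n : nat) (i j : 'I_n) :
  Pmx n i j = if (j <= i)%N then (((2 * (i - j) + 1)`!%:R)^-1)%:P else 0.
Proof.
rewrite summxE; under eq_bigr do rewrite mxE Jmx_expE.
case: leqP => [ji|ij].
  have lt : (i - j < n)%N by rewrite (leq_ltn_trans (leq_subr _ _)).
  rewrite (bigD1 (Ordinal lt)) //= subnKC // eqxx mulr1 big1 ?addr0 // => l.
  rewrite -val_eqE /= => lij; case: eqP => [il|]; rewrite ?mulr0 //.
  by case/eqP: lij; rewrite il addKn.
rewrite big1 // => l _; case: eqP => [il|]; rewrite ?mulr0 //.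
by move: ij; rewrite il ltnNge leq_addr.
Qed.

(* Hence invmx (Dmx m n) is a genuine inverse. *)
Lemma Dmx_unit (m n : nat) : Dmx m n \in unitmx.
Proof.
rewrite unitmxE det_diag rpred_prod // => i _.
by rewrite mxE -polyC_natr poly_unitE size_polyC coefC /= unitfE pnatr_eq0
  -lt0n fact_gt0.
Qed.

(* Main.v *)
(** Put x = 2N+L+1, D = d/dx and let a range over L+1-2q, 0 <= q <= L/2.  The
    (L+1)-fold backward difference in N of the hypersum polynomial S is N^k, and
    up to a shift of N that difference is (2 sinh D)^(L+1), where
    sinh D = D (sinh D / D).  By Cramer's rule the determinant is the last entry
    of (D_m P^-(L+1) D_m^-1) prod (I - a^2 J)^-1 (I - x^2 J)^-1 e_1.  The entries
    of prod (I - a^2 J)^-1 (I - x^2 J)^-1 e_1, multiplied by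
    x^A prod (x^2 - a^2), are x^(m+2i) up to terms of degree at most m - 2; on
    the column of the x^(m+2i) / (m+2i)! the matrix J acts as D^2, hence P acts
    as sinh D / D and P^(L+1) is inverted exactly as the difference equation
    requires.  So S and the right-hand side differ by a polynomial whose
    (L+1)-fold difference is constant; both vanish at N = 0, -1, ..., -(L+1),
    and these L+2 zeros force equality. *)

Require Import Defs.
From HB Require Import structures.
From mathcomp Require Import all_boot all_order all_algebra.
From mathcomp Require Import ring zify.

Set Implicit Arguments.
Unset Strict Implicit.
Unset Printing Implicit Defensive.

Import Order.TTheory GRing.Theory Num.Theory.
Local Open Scope ring_scope.

(** * Backward differences of polynomials *)

Lemma poly_eq_on_nat (R : numDomainType) (n0 : nat) (p q : {poly R}) :
  (forall n : nat, (n0 <= n)%N -> p.[n%:R] = q.[n%:R]) -> p = q.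
Proof.
move=> pq; apply/eqP; rewrite -subr_eq0; set d := _ - _.
apply/negPn/negP => d0.
pose s : seq R := [seq (n0 + i)%:R | i <- iota 0 (size d)].
have sd : all (root d) s.
  apply/allP => _ /mapP[i _ ->].
  by rewrite /root /d !hornerE pq ?leq_addr // subrr.
have us : uniq s.
  rewrite map_inj_uniq ?iota_uniq // => i j /eqP.
  by rewrite eqr_nat eqn_add2l => /eqP.
by have := max_poly_roots d0 sd us; rewrite size_map size_iota ltnn.
Qed.

Definition bdiff (R : nzRingType) (p : {poly R}) : {poly R} :=
  p - (p \Po ('X - 1%:P)).

Lemma horner_bdiff (R : comNzRingType) (p : {poly R}) (a : R) :
  (bdiff p).[a] = p.[a] - p.[a - 1].
Proof. by rewrite /bdiff hornerD hornerN horner_comp hornerXsubC. Qed.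

Lemma iter_bdiffBZ (R : nzRingType) (l : nat) (c : R) (p q : {poly R}) :
  iter l (@bdiff R) (p - c *: q) =
  iter l (@bdiff R) p - c *: iter l (@bdiff R) q.
Proof.
elim: l => //= l ->; rewrite /bdiff comp_polyB comp_polyZ scalerBr !opprB.
by rewrite addrACA [in RHS]addrACA; congr (_ + _); rewrite addrC.
Qed.

Lemma bdiff_inj0 (R : numDomainType) (p : {poly R}) :
  bdiff p = 0 -> p.[0] = 0 -> p = 0.
Proof.
move=> dp p0; apply: (@poly_eq_on_nat _ 0) => n _; rewrite horner0.
elim: n => [//|n IHn]; have := horner_bdiff p n.+1%:R.
by rewrite dp horner0 -natr1 addrK IHn subr0 => <-.
Qed.

(** Each difference costs one zero: [bdiff p] still vanishes at 0, -1, ..., -(l-1), hence is 0 by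
    induction, and then [p] keeps the value [p.[0] = 0] on all naturals. *)
Lemma iter_bdiff_inj0 (R : numDomainType) (l : nat) (p : {poly R}) :
    (forall i : nat, (i <= l)%N -> p.[- i%:R] = 0) ->
  (iter l (@bdiff R) p)^`() = 0 -> p = 0.
Proof.
elim: l p => [|l IHl] p p0.
  move=> /= dp; have /size1_polyC pC : (size p <= 1)%N.
    apply/leq_sizeP => [[//|j]] _; apply/eqP.
    have := congr1 (fun q : {poly R} => q`_j) dp.
    by rewrite coef_deriv coef0 => /eqP; rewrite mulrn_eq0.
  by have := p0 0 isT; rewrite pC hornerC => ->.
rewrite iterSr => dp; apply: bdiff_inj0; last first.
  by have := p0 0%N isT; rewrite mulr0n oppr0.
apply: IHl => // i il; rewrite horner_bdiff !p0 ?subr0 ?(leqW il) //.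
by rewrite -opprD natr1 p0 ?subr0.
Qed.

(** * Central differences and the operator sinh D / D *)

(* [2 sinh D], where [D = (1/2) d/dN] is the derivative in [x = 2N+L+1]. *)
Definition cdiff (F : fieldType) (p : {poly F}) : {poly F} :=
  (p \Po ('X + 2^-1%:P)) - (p \Po ('X - 2^-1%:P)).

(** A backward step is a central step followed by a translation by 1/2. Translations commute with
    [cdiff], so the half-steps add up to l/2. *)
Lemma iter_bdiff_cdiff (F : numFieldType) (l : nat) (p : {poly F}) :
  iter l (@bdiff F) p = iter l (@cdiff F) p \Po ('X - (l%:R / 2)%:P).
Proof.
have h1 : 1%:P = 2^-1%:P + 2^-1%:P :> {poly F}
  by rewrite -polyCD; congr _%:P; field.
elim: l => [|l IHl]; first by rewrite mul0r subr0 comp_polyXr.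
rewrite !iterS IHl /bdiff /cdiff comp_polyB -!comp_polyA.
congr ((_ \Po _) - (_ \Po _)).
all: rewrite !(comp_polyB, comp_polyD, comp_polyX, comp_polyC).
all: rewrite -(natr1 l) mulrDl polyCD mul1r ?h1.
all: by move: (l%:R / 2 : F)%:P (2^-1 : F)%:P => c h; ring.
Qed.

Lemma comp_poly_taylor (F : numFieldType) (n : nat) (p : {poly F}) (c : F) :
  (size p <= n)%N ->
  p \Po ('X + c%:P) = \sum_(i < n) (c ^+ i / i`!%:R) *: p^`(i).
Proof.
move=> pn; rewrite /comp_poly (@nderiv_taylor_wide _ n); first last.
- by rewrite size_map_polyC.
- exact: mulrC.
apply: eq_bigr => i _; rewrite nderivn_map -[_.['X]]/(_ \Po 'X) comp_polyXr.
rewrite -polyC_exp mulrC mul_polyC nderivn_def -scaler_nat scalerA divfK //.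
by rewrite pnatr_eq0 -lt0n fact_gt0.
Qed.

Lemma sum_odd_even (V : nmodType) (n : nat) (f : nat -> V) :
  \sum_(i < n.*2) f i = \sum_(j < n) (f j.*2 + f j.*2.+1).
Proof.
elim: n => [|n IHn]; first by rewrite !big_ord0.
by rewrite doubleS !big_ord_recr /= IHn addrA.
Qed.

(* [sinh D / D] for [D = (1/2) d/dN]. *)
Definition sinhc (F : fieldType) (p : {poly F}) : {poly F} :=
  \sum_(j < size p) (4 ^+ j * (2 * j + 1)`!%:R)^-1 *: p^`(j.*2).

(** Terms beyond the size of [p] are zero derivatives, so different polynomials can share one
    summation range. *)
Lemma sinhc_wide (F : fieldType) (n : nat) (p : {poly F}) : (size p <= n)%N ->
  sinhc p = \sum_(j < n) (4 ^+ j * (2 * j + 1)`!%:R)^-1 *: p^`(j.*2).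
Proof.
move=> pn; rewrite /sinhc (big_ord_widen n
  (fun j => (4 ^+ j * (2 * j + 1)`!%:R)^-1 *: p^`(j.*2))) //.
rewrite [RHS](bigID (fun j : 'I_n => (j < size p)%N)) /=.
rewrite [X in _ + X]big1 ?addr0 // => j; rewrite -leqNgt => pj.
by rewrite derivn_poly0 ?scaler0 // (leq_trans pj) // -addnn leq_addr.
Qed.

(** In the Taylor expansions at 1/2 and -1/2 the even terms cancel and the odd ones double, leaving
    2 (1/2)^(2j+1) = 4^(-j). *)
Lemma cdiffE (F : numFieldType) (p : {poly F}) : cdiff p = sinhc p^`().
Proof.
have sp : (size p <= (size p).*2)%N by rewrite -addnn leq_addr.
rewrite (sinhc_wide (leq_trans (size_poly _ _) (leq_pred (size p)))).
rewrite /cdiff (comp_poly_taylor _ sp) -polyCN (comp_poly_taylor _ sp) -sumrB.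
rewrite (sum_odd_even _ (fun i => (2^-1 ^+ i / i`!%:R) *: p^`(i)
  - ((- 2^-1) ^+ i / i`!%:R) *: p^`(i))); apply: eq_bigr => j _.
rewrite exprNn -signr_odd odd_double expr0 mul1r subrr add0r -scalerBl.
rewrite exprNn -signr_odd oddS odd_double expr1 mulNr mul1r mulNr opprK.
rewrite derivSn mul2n addn1; congr (_ *: _).
have f0 : (j.*2.+1)`!%:R != 0 :> F by rewrite pnatr_eq0 -lt0n fact_gt0.
have -> : 4 = 2 ^+ 2 :> F by ring.
rewrite -exprM mul2n exprS exprVn -mulrDl; field.
by rewrite f0 expf_neq0 // pnatr_eq0.
Qed.

Lemma deriv_sinhc (F : fieldType) (p : {poly F}) : (sinhc p)^`() = sinhc p^`().
Proof.
rewrite (@sinhc_wide _ (size p) p^`());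
  last by rewrite (leq_trans (size_poly _ _) (leq_pred _)) //.
rewrite raddf_sum; apply: eq_bigr => j _ /=.
by rewrite derivZ -derivnS -derivSn.
Qed.

Lemma derivn_sinhc (F : fieldType) (l n : nat) (p : {poly F}) :
  (iter l (@sinhc F) p)^`(n) = iter l (@sinhc F) p^`(n).
Proof.
elim: n p => [//|n IHn] p; rewrite derivnS IHn derivnS.
by elim: l {IHn} => //= l IHl; rewrite deriv_sinhc IHl.
Qed.

Lemma iter_cdiff (F : numFieldType) (l : nat) (p : {poly F}) :
  iter l (@cdiff F) p = iter l (@sinhc F) p^`(l).
Proof.
elim: l p => [//|l IHl] p; rewrite !iterS IHl cdiffE.
rewrite -(derivn1 (iter _ _ _)) derivn_sinhc.
by rewrite derivn1 derivnS.
Qed.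

(** The derivative taken beyond the [l] differences removes the additive constant up to which the
    two sides of the theorem are first compared. *)
Lemma deriv_iter_bdiff (F : numFieldType) (l : nat) (p : {poly F}) :
  (iter l (@bdiff F) p)^`() =
  iter l (@sinhc F) p^`(l.+1) \Po ('X - (l%:R / 2)%:P).
Proof.
rewrite iter_bdiff_cdiff deriv_comp derivXsubC mulr1 iter_cdiff -derivn1.
by rewrite derivn_sinhc derivn1 derivnS.
Qed.

(** * Differences and zeros of the hypersum polynomials *)

Lemma hypersum_poly0_bdiff (k : nat) : bdiff (hypersum_poly 0 k) = 'X^k.
Proof.
(* Starting at 2 keeps both N and N - 1 positive, where interpolation is known. *)
apply: (@poly_eq_on_nat _ 2) => -[|[|n]] // _.
rewrite horner_bdiff hornerXn -(natr1 n.+1) addrK natr1 !hypersum_polyP //=.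
by rewrite big_nat_recr //= natrD natrX [LHS]addrC addKr.
Qed.

Lemma hypersum_polyS_bdiff (L k : nat) :
  bdiff (hypersum_poly L.+1 k) = hypersum_poly L k.
Proof.
apply: (@poly_eq_on_nat _ 2) => -[|[|n]] // _.
rewrite horner_bdiff -(natr1 n.+1) addrK natr1 !hypersum_polyP //=.
by rewrite big_nat_recr //= natrD [LHS]addrC addKr.
Qed.

Lemma iter_bdiff_hypersum_poly (L k : nat) :
  iter L.+1 (@bdiff rat) (hypersum_poly L k) = 'X^k.
Proof.
elim: L => [|L IHL]; first exact: hypersum_poly0_bdiff.
by rewrite iterSr hypersum_polyS_bdiff.
Qed.

Lemma hypersum_poly1 (L k : nat) : (hypersum_poly L k).[1] = 1.
Proof.
have := @hypersum_polyP L k 1 isT; rewrite mulr1n => ->.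
suff -> : hypersum L k 1 = 1%N by [].
by elim: L => [|L IHL]; rewrite /= big_nat1 ?exp1n.
Qed.

(** Interpolation says nothing at N = 0. The value there follows from the difference at N = 1, since
    both that difference and the polynomial equal 1 at N = 1. *)
Lemma hypersum_poly_root0 (L k : nat) : (hypersum_poly L k).[0] = 0.
Proof.
have root0 q : bdiff (hypersum_poly L k) = q -> q.[1] = 1 ->
    (hypersum_poly L k).[0] = 0.
  move=> dq q1; have := horner_bdiff (hypersum_poly L k) 1.
  by rewrite dq q1 subrr hypersum_poly1 => /esym/eqP;
    rewrite subr_eq -subr_eq0 opprD addNKr oppr_eq0 => /eqP.
case: L root0 => [|L] root0.
  by apply: root0 (hypersum_poly0_bdiff k) _; rewrite hornerXn expr1n.
by apply: root0 (hypersum_polyS_bdiff L k) _; rewrite hypersum_poly1.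
Qed.

(** Zeros propagate downwards from N = 0: S(-i-1) is S(-i) minus the difference at -i, and that
    difference is the hypersum of the previous level, or N^k when L = 0. The latter vanishes at 0
    because k > 0. *)
Lemma hypersum_poly_root (L k i : nat) :
  (0 < k)%N -> (i <= L.+1)%N -> (hypersum_poly L k).[- i%:R] = 0.
Proof.
move=> k0; elim: L i => [|L IHL] i.
  case: i => [|[|//]] _; first by rewrite mulr0n oppr0 hypersum_poly_root0.
  have := horner_bdiff (hypersum_poly 0 k) 0.
  rewrite hypersum_poly0_bdiff hornerXn expr0n eqn0Ngt k0 hypersum_poly_root0.
  by rewrite !sub0r => /esym/eqP; rewrite oppr_eq0 => /eqP.
elim: i => [|i IHi] iL; first by rewrite mulr0n oppr0 hypersum_poly_root0.
have := horner_bdiff (hypersum_poly L.+1 k) (- i%:R).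
rewrite hypersum_polyS_bdiff IHL // IHi 1?ltnW // -opprD natr1.
by rewrite sub0r => /esym/eqP; rewrite oppr_eq0 => /eqP.
Qed.

(** * Matrices with constant entries *)

(** Constancy is encoded by vanishing derivatives, which is exactly what lets such a matrix pass
    through entrywise differentiation. *)
Definition constant_mx (F : fieldType) (m n : nat) (B : 'M[{poly F}]_(m, n)) :=
  forall i j, (B i j)^`() = 0.

Lemma derivn_mull (F : fieldType) (l : nat) (b p : {poly F}) :
  b^`() = 0 -> (b * p)^`(l) = b * p^`(l).
Proof.
move=> db; elim: l => [//|l IHl].
by rewrite !derivnS IHl derivM db mul0r add0r.
Qed.

Lemma derivn_add (F : fieldType) (a b : nat) (p : {poly F}) :
  p^`(a)^`(b) = p^`(b + a).
Proof. by rewrite /derivn iterD. Qed.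

Lemma derivn_mulmx (F : fieldType) (l m n p : nat) (B : 'M[{poly F}]_(m, n))
    (V : 'M[{poly F}]_(n, p)) :
  constant_mx B -> map_mx (derivn l) (B *m V) = B *m map_mx (derivn l) V.
Proof.
move=> cB; apply/matrixP => i j; rewrite !mxE raddf_sum; apply: eq_bigr => q _.
by rewrite mxE /= derivn_mull.
Qed.

Lemma constant_mxM (F : fieldType) (m n p : nat) (B : 'M[{poly F}]_(m, n))
    (C : 'M[{poly F}]_(n, p)) :
  constant_mx B -> constant_mx C -> constant_mx (B *m C).
Proof.
move=> cB cC i j; rewrite mxE raddf_sum big1 // => q _ /=.
by rewrite derivM cB cC mul0r mulr0 addr0.
Qed.

Lemma constant_mx1 (F : fieldType) (n : nat) :
  constant_mx (1 : 'M[{poly F}]_n).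
Proof. by move=> i j; rewrite mxE -polyC_natr derivC. Qed.

Lemma constant_mxX (F : fieldType) (n l : nat) (B : 'M[{poly F}]_n) :
  constant_mx B -> constant_mx (B ^+ l).
Proof.
move=> cB; elim: l => [|l IHl]; first exact: constant_mx1.
by rewrite exprS; apply: constant_mxM.
Qed.

Lemma constant_mx_Pmx (n : nat) : constant_mx (Pmx n).
Proof. by move=> i j; rewrite PmxE; case: ifP => _; rewrite derivC. Qed.

Lemma constant_mx_Dmx (m n : nat) : constant_mx (Dmx m n).
Proof.
by move=> i j; rewrite !mxE derivMn -polyC_natr derivC mul0rn.
Qed.

Lemma constant_mx_shift (n : nat) (c : rat) :
  constant_mx (1 - c%:P *: Jmx n).
Proof.
move=> i j; rewrite !mxE derivB derivM -!polyC_natr !derivC.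
by rewrite mul0r mulr0 addr0 subrr.
Qed.

Lemma constant_mx_prod_shift (n : nat) (s : seq rat) :
  constant_mx (\prod_(c <- s) (1 - c%:P *: Jmx n)).
Proof.
elim: s => [|c s IHs]; first by rewrite big_nil; apply: constant_mx1.
by rewrite big_cons; apply: constant_mxM => //; apply: constant_mx_shift.
Qed.

(** * Unitriangular factors and their invertibility *)

Lemma det_shift (n : nat) (c : {poly rat}) : \det (1 - c *: Jmx n) = 1.
Proof.
rewrite det_trig; last first.
  apply/is_trig_mxP => i j ij; rewrite !mxE -val_eqE /= (ltn_eqF ij).
  by rewrite (ltn_eqF (ltnW ij : i < j.+1)%N) mulr0 subrr.
apply: big1 => i _; rewrite !mxE eqxx.
by rewrite (ltn_eqF (ltnSn i)) mulr0 subr0.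
Qed.

Lemma det_Pmx (n : nat) : \det (Pmx n) = 1.
Proof.
rewrite det_trig; last first.
  by apply/is_trig_mxP => i j ij; rewrite PmxE leqNgt ij.
by apply: big1 => i _; rewrite PmxE leqnn subnn invr1.
Qed.

Lemma unitmx_prod_shift (n : nat) (s : seq rat) :
  \prod_(c <- s) (1 - c%:P *: Jmx n) \in unitmx.
Proof.
elim: s => [|c s IHs]; first by rewrite big_nil unitmx1.
by rewrite big_cons unitmx_mul IHs unitmxE det_shift unitr1.
Qed.

Lemma unitmx_Pmx_exp (n l : nat) : Pmx n ^+ l \in unitmx.
Proof.
elim: l => [|l IHl]; first exact: unitmx1.
by rewrite exprS unitmx_mul IHl unitmxE det_Pmx unitr1.
Qed.

(** * The shift matrix as a second derivative *)

Lemma Jmx_mul_col (n : nat) (f : nat -> {poly rat}) :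
  Jmx n *m (\col_i f i) = \col_i (if (i : nat) is i'.+1 then f i' else 0).
Proof.
apply/matrixP => i j; rewrite !mxE; case: i => [[|i] iP] /=.
  by rewrite big1 // => q _; rewrite !mxE mul0r.
rewrite (bigD1 (Ordinal (ltnW iP))) //= !mxE eqxx mul1r big1 ?addr0 // => q.
by rewrite -val_eqE /= !mxE /= eqSS eq_sym => /negPf ->; rewrite mul0r.
Qed.

Lemma comm_Jmx_Pmx (n l : nat) : Jmx n *m Pmx n ^+ l = Pmx n ^+ l *m Jmx n.
Proof.
apply: commrX; apply: commr_sum => q _; rewrite /GRing.comm.
rewrite -!mulmxE -scalemxAr -scalemxAl; congr (_ *: _).
exact: commrX.
Qed.

(* [D ^ 2] for [D = (1/2) d/dN]. *)
Definition quarter_deriv2 (F : fieldType) (p : {poly F}) : {poly F} :=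
  4^-1 *: p^`(2).

Lemma quarter_deriv2_mulmx (F : fieldType) (m n p : nat)
    (B : 'M[{poly F}]_(m, n)) (V : 'M[{poly F}]_(n, p)) :
  constant_mx B -> map_mx (@quarter_deriv2 F) (B *m V) =
                   B *m map_mx (@quarter_deriv2 F) V.
Proof.
move=> cB; have := derivn_mulmx 2 V cB => /matrixP dBV; apply/matrixP => i j.
have := dBV i j; rewrite !mxE /quarter_deriv2 => ->; rewrite scaler_sumr.
by apply: eq_bigr => q _; rewrite !mxE -scalerAr.
Qed.

Lemma iter_quarter_deriv2 (F : fieldType) (q : nat) (p : {poly F}) :
  iter q (@quarter_deriv2 F) p = (4 ^+ q)^-1 *: p^`(q.*2).
Proof.
elim: q => [|q IHq]; first by rewrite expr0 invr1 scale1r.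
rewrite iterS IHq /quarter_deriv2 derivnZ scalerA derivn_add.
by rewrite exprS invfM.
Qed.

Lemma iter_quarter_deriv2_Jmx (n q : nat) (u : 'cV[{poly rat}]_n) :
  map_mx (@quarter_deriv2 rat) u = Jmx n *m u ->
  map_mx (iter q (@quarter_deriv2 rat)) u = Jmx n ^+ q *m u.
Proof.
have cJ j : constant_mx (Jmx n ^+ j).
  by move=> i l; rewrite Jmx_expE -polyC_natr derivC.
move=> du; elim: q => [|q IHq].
  by rewrite expr0 mul1mx; apply/matrixP => i j; rewrite mxE.
transitivity (map_mx (@quarter_deriv2 rat) (Jmx n ^+ q *m u)).
  by rewrite -IHq; apply/matrixP => i j; rewrite !mxE.
by rewrite quarter_deriv2_mulmx // du mulmxA exprSr.
Qed.

(** Where D^2 acts as J, the series of D^(2q) / (2q+1)! turns term by term into the series defining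
    P. *)
Lemma map_sinhc_Jmx (n : nat) (u : 'cV[{poly rat}]_n) :
  map_mx (@quarter_deriv2 rat) u = Jmx n *m u ->
  map_mx (@sinhc rat) u = Pmx n *m u.
Proof.
move=> du; apply/matrixP => i j; rewrite mxE.
(* This range covers all nonzero derivatives of the entry and all nonzero powers of J. *)
rewrite (sinhc_wide (leq_maxr n (size (u i j)))).
set f := fun q : nat => ((2 * q + 1)`!%:R)^-1 *: (Jmx n ^+ q *m u) i j.
transitivity (\sum_(q < maxn n (size (u i j))) f q).
  apply: eq_bigr => q _; rewrite /f -iter_quarter_deriv2_Jmx // mxE.
  by rewrite iter_quarter_deriv2 scalerA invfM mulrC.
transitivity (\sum_(q < n) f q).
  rewrite (big_ord_widen _ f (leq_maxl n (size (u i j)))).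
  rewrite [LHS](bigID (fun q : 'I__ => (q < n)%N)) /=.
  rewrite [X in _ + X]big1 ?addr0 // => q; rewrite -leqNgt => nq; rewrite /f mxE big1 ?scaler0 // => a _.
  rewrite Jmx_expE (_ : _ == _ = false) ?mul0r //; apply/ltn_eqF.
  by rewrite (leq_trans (ltn_ord i)) // (leq_trans nq) // leq_addl.
rewrite /Pmx mulmx_suml summxE; apply: eq_bigr => q _.
by rewrite /f -scalemxAl [in RHS]mxE mul_polyC.
Qed.

Lemma iter_sinhc_Jmx (n l : nat) (u : 'cV[{poly rat}]_n) :
  map_mx (@quarter_deriv2 rat) u = Jmx n *m u ->
  map_mx (iter l (@sinhc rat)) u = Pmx n ^+ l *m u.
Proof.
move=> du; elim: l => [|l IHl].
  by rewrite expr0 mul1mx; apply/matrixP => i j; rewrite mxE.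
transitivity (map_mx (@sinhc rat) (Pmx n ^+ l *m u)).
  by rewrite -IHl; apply/matrixP => i j; rewrite !mxE.
rewrite map_sinhc_Jmx ?mulmxA ?exprS //.
rewrite quarter_deriv2_mulmx; last exact/constant_mxX/constant_mx_Pmx.
by rewrite du !mulmxA comm_Jmx_Pmx.
Qed.

(** P^l is constant, invertible and commutes with J, so the relation pulls back from [w], where it
    can be computed, to [u], where it is needed. *)
Lemma quarter_deriv2_Pmx_cancel (n l : nat) (u : 'cV[{poly rat}]_n) :
  let w := Pmx n ^+ l *m u in
  map_mx (@quarter_deriv2 rat) w = Jmx n *m w ->
  map_mx (@quarter_deriv2 rat) u = Jmx n *m u.
Proof.
move=> w dw; apply: (can_inj (mulKmx (unitmx_Pmx_exp n l))).
rewrite -quarter_deriv2_mulmx ?dw /w ?mulmxA ?comm_Jmx_Pmx //.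
exact/constant_mxX/constant_mx_Pmx.
Qed.

(** * The factors I - cJ modulo terms of low degree *)

Lemma size_exp_prod_leq (F : fieldType) (x : {poly F}) (s : seq F) (a : nat) :
  (size x <= 2)%N ->
  (size (x ^+ a * \prod_(c <- s) (x ^+ 2 - c%:P))%R <= (a + 2 * size s).+1)%N.
Proof.
move=> sx; elim: s a => [|c s IHs] a.
  rewrite big_nil mulr1 (leq_trans (size_poly_exp_leq _ _)) // muln0 addn0 ltnS.
  by rewrite -[leqRHS]mul1n leq_mul2r -subn1 leq_subLR sx orbT.
rewrite big_cons mulrA mulrBr -exprD mulrBl (leq_trans (size_polyD _ _)) //.
rewrite geq_max size_polyN (leq_trans (IHs _)) /=; last by lia.
rewrite [_ * c%:P]mulrC -mulrA mul_polyC (leq_trans (size_scale_leq _ _)) //.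
by rewrite (leq_trans (IHs _)) /=; lia.
Qed.

(* Multiplying by [1 - c J] replaces the factor [x ^ 2] of each entry by
   [x ^ 2 - c], except in the first row, where the error has degree [m - 2] and
   is killed by the [H]-fold derivative. *)
Lemma derivn_prod_shift (n m H : nat) (x : {poly rat}) (s : seq rat) :
    (size x <= 2)%N -> (2 * size s <= m)%N -> (m <= H.+1)%N ->
  map_mx (derivn H)
    (\prod_(c <- s) (1 - c%:P *: Jmx n) *m \col_i x ^+ (m + 2 * i)) =
  map_mx (derivn H)
    (\col_i (x ^+ (m - 2 * size s + 2 * i) * \prod_(c <- s) (x ^+ 2 - c%:P))).
Proof.
move=> sx sm mH; elim: s sm => [|c s IHs] sm.
  rewrite big_nil mul1mx; apply/matrixP => i j; rewrite !mxE.
  by rewrite big_nil mulr1 muln0 subn0.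
rewrite big_cons -mulmxE -mulmxA derivn_mulmx; last exact: constant_mx_shift.
(* The induction hypothesis holds only under the [H]-fold derivative, which is moved past the
   constant factor and then back. *)
rewrite IHs; last by move: sm => /=; lia.
rewrite -derivn_mulmx; last exact: constant_mx_shift.
rewrite mulmxBl mul1mx -scalemxAl.
rewrite (Jmx_mul_col _ (fun i => x ^+ (m - 2 * size s + 2 * i) *
  \prod_(c <- s) (x ^+ 2 - c%:P))).
apply/matrixP => i j; rewrite !mxE big_cons /=.
set g := \prod_(c <- s) _.
case: i => [[|i] iP] /=; last first.
  congr derivn; have -> : (m - 2 * size s + 2 * i.+1 =
      m - 2 * (size s).+1 + 2 * i.+1 + 2)%N by move: sm => /=; lia.
  have -> : (m - 2 * size s + 2 * i = m - 2 * (size s).+1 + 2 * i.+1)%N.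
    by move: sm => /=; lia.
  by rewrite exprD; ring.
rewrite mulr0 subr0 muln0 !addn0.
have -> : (m - 2 * size s = m - 2 * (size s).+1 + 2)%N by move: sm => /=; lia.
set b := (m - _)%N.
have -> : x ^+ b * ((x ^+ 2 - c%:P) * g) =
    x ^+ (b + 2) * g - c%:P * (x ^+ b * g) by rewrite exprD; ring.
rewrite derivnB [X in _ - X]derivn_mull ?derivC // (_ : (x ^+ b * g)^`(H) = 0).
  by rewrite mulr0 subr0.
apply: derivn_poly0; rewrite (leq_trans (size_exp_prod_leq _ _ sx)) //.
by rewrite /b; move: sm => /=; lia.
Qed.

(** * Cramer's rule for the last column *)

(** The last column of [M] is the last basis vector, so the matrix on the left is [M] with that
    column replaced by [w]. It factors as [M] times the identity with last column [v], which is
    upper triangular. *)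
Lemma det_replace_last_col (R : comNzRingType) (n : nat) (M : 'M[R]_n.+1)
    (v w : 'cV[R]_n.+1) :
    M *m delta_mx ord_max 0 = delta_mx ord_max 0 :> 'cV_n.+1 -> M *m v = w ->
  \det (M - delta_mx ord_max ord_max + w *m delta_mx 0 ord_max) =
  \det M * v ord_max 0.
Proof.
move=> Me Mv; set e : 'cV_n.+1 := delta_mx _ 0 in Me.
have -> : M - delta_mx ord_max ord_max + w *m delta_mx 0 ord_max =
    M *m (1%:M + (v - e) *m delta_mx 0 ord_max).
  rewrite mulmxDr mulmx1 mulmxA mulmxBr Mv Me mulmxBl mul_delta_mx.
  by rewrite addrAC addrA.
rewrite det_mulmx; congr (_ * _); rewrite -det_tr det_trig.
  rewrite big_ord_recr /= big1 => [|i _].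
    by rewrite !mxE big_ord1 !mxE !eqxx /= mulr1 mul1r addrC subrK.
  rewrite !mxE big_ord1 !mxE eqxx eqE /= (ltn_eqF (ltn_ord i)).
  by rewrite mulr0 addr0.
apply/is_trig_mxP => i j ij; rewrite !mxE big_ord1 !mxE [j == i]eq_sym.
rewrite -!val_eqE /= (ltn_eqF ij) (ltn_eqF (leq_trans ij _)) ?mulr0 ?addr0 //.
by rewrite -ltnS.
Qed.

(** * Divided powers of x *)

Definition divpow (F : fieldType) (x : {poly F}) (a : nat) : {poly F} :=
  a`!%:R^-1 *: x ^+ a.

Lemma derivn_divpow (F : numFieldType) (x : {poly F}) (a b : nat) :
  x^`() = 2 -> (divpow x (a + b))^`(b) = 2 ^+ b *: divpow x a.
Proof.
move=> dx; elim: b => [|b IHb]; first by rewrite addn0 scale1r.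
rewrite derivSn addnS [(divpow _ _)^`()](_ : _ = 2 *: divpow x (a + b)).
  by rewrite derivnZ IHb scalerA exprS.
rewrite /divpow derivZ deriv_exp dx /= mulr_natl -mulrnA -scaler_nat !scalerA.
congr (_ *: _); rewrite factS !natrM; field.
by rewrite -natrD nat1r !pnatr_eq0 -lt0n fact_gt0.
Qed.

Lemma Dmx_mul_divpow (m n : nat) (x : {poly rat}) :
  Dmx m n *m \col_i divpow x (m + 2 * i) = \col_i x ^+ (m + 2 * i).
Proof.
apply/matrixP => i j; rewrite mul_diag_mx !mxE /divpow -polyC_natr mul_polyC.
by rewrite scalerA mulfV ?scale1r // pnatr_eq0 -lt0n fact_gt0.
Qed.

(** As x' = 2, D is d/dx and D^2 lowers the exponent of a divided power by 2, that is, moves to the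
    previous row. In the first row J gives 0, and so do H + 2 derivatives of a power of degree m <=
    H + 1. *)
Lemma quarter_deriv2_divpow (m n H : nat) (x : {poly rat}) :
    x^`() = 2 -> (size x <= 2)%N -> (m <= H.+1)%N ->
  let w := map_mx (derivn H) (\col_(i < n) divpow x (m + 2 * i)) in
  map_mx (@quarter_deriv2 rat) w = Jmx n *m w.
Proof.
move=> dx sx mH w.
have -> : w = \col_i (divpow x (m + 2 * i))^`(H).
  by apply/matrixP => i j; rewrite !mxE.
rewrite (Jmx_mul_col _ (fun i => (divpow x (m + 2 * i))^`(H))).
apply/matrixP => -[[|i] iP] j; rewrite !mxE /quarter_deriv2 derivn_add.
  rewrite -[LHS]/(_ *: (divpow x (m + 0))^`(2 + H)) addn0.
  rewrite derivn_poly0 ?scaler0 //.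
  rewrite (leq_trans (size_scale_leq _ _)) //.
  have := size_exp_prod_leq [::] m sx.
  by rewrite big_nil mulr1 muln0 addn0 => /leq_trans; apply.
rewrite -[LHS]/(_ *: (divpow x (m + 2 * i.+1))^`(2 + H)) addnC -derivn_add.
rewrite mulnS [(2 + _)%N]addnC addnA derivn_divpow //.
by rewrite derivnZ scalerA mulVf ?scale1r.
Qed.

(** * The corner matrices and the fixed last basis vector *)

Lemma Kmx_0E (n : nat) :
  Kmx n.+1 0 = delta_mx ord_max ord_max.
Proof.
by apply/matrixP => i j; rewrite !mxE subn0 !eqSS -!val_eqE.
Qed.

(** The column-times-row form fits [det_replace_last_col] with [w] the first basis vector. *)
Lemma Kmx_predE (n : nat) :
  Kmx n.+1 n = (delta_mx 0 0 : 'cV_n.+1) *m delta_mx 0 ord_max.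
Proof.
by apply/matrixP => i j; rewrite mul_delta_mx !mxE subSnn !eqSS -!val_eqE.
Qed.

Lemma Jmx_mul_last (n : nat) :
  Jmx n.+1 *m delta_mx ord_max 0 = 0 :> 'cV_n.+1.
Proof.
by apply/matrixP => i j; rewrite -colE !mxE (ltn_eqF (ltn_ord i)).
Qed.

Lemma shift_mul_last (n : nat) (c : {poly rat}) :
  (1 - c *: Jmx n.+1) *m delta_mx ord_max 0 = delta_mx ord_max 0 :> 'cV_n.+1.
Proof. by rewrite mulmxBl mul1mx -scalemxAl Jmx_mul_last scaler0 subr0. Qed.

Lemma prod_shift_mul_last (n : nat) (s : seq rat) :
  \prod_(c <- s) (1 - c%:P *: Jmx n.+1) *m delta_mx ord_max 0 =
  delta_mx ord_max 0 :> 'cV_n.+1.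
Proof.
elim: s => [|c s IHs]; first by rewrite big_nil mul1mx.
by rewrite big_cons -mulmxE -mulmxA IHs shift_mul_last.
Qed.

Lemma Pmx_exp_mul_last (n l : nat) :
  Pmx n.+1 ^+ l *m delta_mx ord_max 0 = delta_mx ord_max 0 :> 'cV_n.+1.
Proof.
elim: l => [|l IHl]; first by rewrite mul1mx.
rewrite exprSr -mulmxE -mulmxA [Pmx _ *m _](_ : _ = delta_mx ord_max 0) //.
apply/matrixP => i j; rewrite -colE mxE PmxE !mxE -val_eqE /= ord1 eqxx andbT.
case: (ltngtP i n) => [//|ni|->].
  by have := ltn_ord i; rewrite ltnS leqNgt ni.
by rewrite subnn invr1.
Qed.

Lemma Dmx_conj_mul_last (m n : nat) (B : 'M[{poly rat}]_n.+1) :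
  B *m delta_mx ord_max 0 = delta_mx ord_max 0 :> 'cV_n.+1 ->
  Dmx m n.+1 *m B *m invmx (Dmx m n.+1) *m delta_mx ord_max 0 =
  delta_mx ord_max 0 :> 'cV_n.+1.
Proof.
move=> Be; set e := delta_mx _ _ in Be *.
have De : Dmx m n.+1 *m e = (m + 2 * n)`!%:R *: e.
  apply/matrixP => i j; rewrite mul_diag_mx !mxE -val_eqE /=.
  by case: eqP => [->|] //=; rewrite !mulr0.
have Ie : invmx (Dmx m n.+1) *m e = ((m + 2 * n)`!%:R^-1)%:P *: e.
  apply: (can_inj (mulKmx (Dmx_unit m n.+1))).
  rewrite mulKVmx ?Dmx_unit // -scalemxAr De scalerA -polyC_natr -polyCM.
  by rewrite mulVf ?scale1r // pnatr_eq0 -lt0n fact_gt0.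
rewrite -!mulmxA Ie -!scalemxAr Be De scalerA -polyC_natr -polyCM.
by rewrite mulVf ?scale1r // pnatr_eq0 -lt0n fact_gt0.
Qed.

(** * Evaluation of the determinant *)

(** Telescoping: the geometric column is the first column of the inverse of I - zJ. *)
Lemma shift_mul_geom (n : nat) (z : {poly rat}) :
  (1 - z *: Jmx n.+1) *m (\col_i z ^+ i) = delta_mx 0 0.
Proof.
rewrite mulmxBl mul1mx -scalemxAl (Jmx_mul_col _ (fun i => z ^+ i)).
apply/matrixP => -[[|i] iP] j; rewrite !mxE -!val_eqE /= ?mulr0 ?subr0.
  by rewrite ord1 eqxx expr0.
by rewrite -exprS subrr.
Qed.

(* By Cramer's rule the determinant is the last entry of the solution [v] of
   [M v = e_1], since [det M = 1].  The size [n'] is kept abstract so that ['M_n']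
   carries the ring structure inferred for a matrix of arbitrary size, which
   differs syntactically from the one inferred for ['M_n.+1]. *)
Lemma det_hypersum_mx (n n' m l H : nat) (x : {poly rat}) (s : seq rat) :
    n' = n.+1 -> x^`() = 2 -> (size x <= 2)%N -> (2 * size s <= m)%N ->
    (m <= H.+1)%N ->
  let D := Dmx m n' in
  let M := (1 - x ^+ 2 *: Jmx n') * \prod_(c <- s) (1 - c%:P *: Jmx n')
    * (D * Pmx n' ^+ l * invmx D) in
  exists2 t : {poly rat},
    x ^+ (m - 2 * size s) * (\prod_(c <- s) (x ^+ 2 - c%:P))
      * \det (M - Kmx n' 0 + Kmx n' (n' - 1)) = (m + 2 * n)`!%:R *: t &
    iter l (@sinhc rat) t^`(H) = (divpow x (m + 2 * n))^`(H).
Proof.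
move=> -> {n'} dx sx sm mH D M; rewrite subSS subn0.
set X := 1 - x ^+ 2 *: _ in M *; set Q := \prod_(c <- s) (1 - _) in M *.
set P := Pmx n.+1 in M *; set G := \prod_(c <- s) (x ^+ 2 - _).
have uD : D \in unitmx by apply: Dmx_unit.
have uQ : Q \in unitmx by apply: unitmx_prod_shift.
have uX : X \in unitmx by rewrite unitmxE det_shift unitr1.
have detX : \det X = 1 by apply: det_shift.
have cP : constant_mx (P ^+ l) by apply/constant_mxX/constant_mx_Pmx.
have cD : constant_mx D by apply: constant_mx_Dmx.
have detM : \det M = 1.
  have detQ : \det Q = 1.
    rewrite /Q; elim: (s) => [|c r IHr]; first by rewrite big_nil det1.
    by rewrite big_cons det_mulmx det_shift IHr mulr1.
  have detP : \det (P ^+ l) = 1.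
    elim: (l) => [|j IHj]; first by rewrite expr0 det1.
    by rewrite exprS det_mulmx det_Pmx IHj mulr1.
  by rewrite !det_mulmx detX detQ detP !mulr1 mul1r -det_mulmx mulmxV // det1.
have uM : M \in unitmx by rewrite unitmxE detM unitr1.
pose v := invmx M *m (delta_mx 0 0 : 'cV_n.+1).
have Mv : M *m v = delta_mx 0 0 by rewrite mulKVmx.
have Me : M *m delta_mx ord_max 0 = delta_mx ord_max 0 :> 'cV_n.+1.
  have De := Dmx_conj_mul_last m (Pmx_exp_mul_last n l).
  rewrite -!mulmxA in De.
  by rewrite /M -!mulmxE -!mulmxA De prod_shift_mul_last shift_mul_last.
rewrite Kmx_0E Kmx_predE (det_replace_last_col Me Mv) detM mul1r.
set g := x ^+ _ * G.
(* Stripping [X] from M v = e_1 leaves [Q *m w] equal to the geometric column in x^2. *)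
pose w := D *m P ^+ l *m invmx D *m v.
have Qw : Q *m w = \col_i (x ^+ 2) ^+ i.
  apply: (can_inj (mulKmx uX)); rewrite shift_mul_geom -Mv /M /w.
  by rewrite -!mulmxE !mulmxA.
(* By [derivn_prod_shift], [Q] sends the column of x^(m+2i) to [g] times the geometric column, up to
   terms killed by H derivatives. [Q] then cancels. *)
have Qhi : map_mx (derivn H) (g *: w) =
    map_mx (derivn H) (\col_i x ^+ (m + 2 * i)).
  apply: (can_inj (mulKmx uQ)).
  have cQ : constant_mx Q by apply: constant_mx_prod_shift.
  rewrite -!derivn_mulmx // derivn_prod_shift // -scalemxAr Qw.
  congr map_mx; apply/matrixP => i j; rewrite !mxE -exprM exprD /g.
  by rewrite mulrAC.
(* Dividing by the factorials in [D] undoes the conjugation, so that P^l alone relates [th] to the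
   divided powers. *)
pose th := invmx D *m (g *: v).
have Phi : P ^+ l *m map_mx (derivn H) th =
    map_mx (derivn H) (\col_i divpow x (m + 2 * i)).
  rewrite -derivn_mulmx //; apply: (can_inj (mulKmx uD)).
  rewrite -!derivn_mulmx // Dmx_mul_divpow -Qhi; congr map_mx.
  by rewrite /th /w !mulmxA -scalemxAr !mulmxA.
exists (th ord_max 0).
  have -> : g * v ord_max 0 = (D *m th) ord_max 0.
    by rewrite mulKVmx // [RHS]mxE.
  move: (th) => u; rewrite /D /Dmx mul_diag_mx !mxE.
  by rewrite -polyC_natr mul_polyC.
(* With D^2 acting as J on this column, [sinhc] acts as P, and [Phi] becomes the required equation
   in the last row. *)
have dth : map_mx (@quarter_deriv2 rat) (map_mx (derivn H) th) =
    Jmx n.+1 *m map_mx (derivn H) th.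
  by apply: (@quarter_deriv2_Pmx_cancel _ l); rewrite Phi quarter_deriv2_divpow.
have := iter_sinhc_Jmx l dth; rewrite Phi => /matrixP/(_ ord_max 0).
by move: (th) => u; rewrite !mxE.
Qed.

(** * The substitutions x = 2N+L+1 and y = N(N+L+1) *)

Lemma deriv_sqrtsub (L : nat) : (sqrtsub L)^`() = 2.
Proof.
by rewrite /sqrtsub derivD derivM derivX -!polyC_natr !derivC mul0r add0r mulr1
  addr0.
Qed.

Lemma size_sqrtsub (L : nat) : (size (sqrtsub L) <= 2)%N.
Proof.
by rewrite /sqrtsub -!polyC_natr size_MXaddC polyC_eq0 pnatr_eq0 ltnS
  size_polyC leq_b1.
Qed.

Lemma horner_sqrtsub (L : nat) (a : rat) :
  (sqrtsub L).[a] = 2 * a + (L + 1)%:R.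
Proof. by rewrite /sqrtsub -!polyC_natr !hornerE. Qed.

Lemma horner_ysub (L : nat) (a : rat) : (ysub L).[a] = a * (a + (L + 1)%:R).
Proof. by rewrite /ysub -!polyC_natr !hornerE. Qed.

Lemma comp_sqrtsub (L : nat) :
  sqrtsub L \Po ('X - (L.+1%:R / 2)%:P) = 2%:P * 'X.
Proof.
rewrite /sqrtsub -!polyC_natr comp_polyD comp_polyM !comp_polyC comp_polyX.
rewrite mulrBr -polyCM addn1 mulrC -addrA -polyCN -polyCD.
by rewrite [X in _ + X%:P](_ : _ = 0) ?addr0 1?mulrC //; field.
Qed.

(** Since 2q <= L, the natural-number subtraction is exact. *)
Definition squares (L : nat) : seq rat :=
  [seq (L + 1 - 2 * q)%:R ^+ 2 | q <- index_iota 0 (L %/ 2).+1].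

(** Difference of squares: (L+1)^2 - (L+1-2q)^2 = 4q(L+1-q), while x^2 = 4y + (L+1)^2. *)
Lemma prod_ysub_shift (L : nat) :
  \prod_(0 <= q < (L %/ 2).+1) (ysub L + (q * (L + 1 - q))%:R) =
  (4^-1 ^+ (L %/ 2).+1)%:P *
    \prod_(c <- squares L) (sqrtsub L ^+ 2 - c%:P).
Proof.
rewrite /squares big_map polyC_exp -[X in _ ^+ X](subn0 (L %/ 2).+1).
rewrite -prodr_const_nat -big_split /=; apply: eq_big_nat => q /andP[_ qL].
rewrite sqrtsub_sqr polyC_exp !polyC_natr.
have -> : (L + 1 = (L + 1 - 2 * q) + 2 * q)%N by lia.
set a := (L + 1 - 2 * q)%N; have -> : (a + 2 * q - q = a + q)%N by lia.
rewrite addnK; have b4 : (4^-1 : rat)%:P * 4 = 1.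
  by rewrite -(polyC_natr _ 4%N) -polyCM mulVf.
have quarter (R : comNzRingType) (y b : R) : b * 4 = 1 ->
    y + (q * (a + q))%:R = b * (4 * y + (a + 2 * q)%:R ^+ 2 - a%:R ^+ 2).
  rewrite !natrD !natrM natrD; move: (a%:R) (q%:R) => u w b4'.
  by transitivity (b * 4 * (y + w * (u + w))); [rewrite b4' mul1r | ring].
exact: quarter.
Qed.

(** The factor with index q is (N+q)(N+L+1-q), with zeros -q and -(L+1-q). These miss only -(L+1)/2
    for odd L, where x itself vanishes and has exponent at least 1. *)
Lemma sqrtsub_prod_ysub_root0 (L k i : nat) : (i <= L.+1)%N ->
  (sqrtsub L ^+ (L %% 2 + (k + 1) %% 2) *
   \prod_(0 <= q < (L %/ 2).+1) (ysub L + (q * (L + 1 - q))%:R)).[- i%:R] = 0.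
Proof.
move=> iL; rewrite hornerM horner_exp horner_sqrtsub horner_prod.
have factor0 q : (q <= L %/ 2)%N -> (i = q \/ i = L + 1 - q)%N ->
    \prod_(0 <= j < (L %/ 2).+1)
       (ysub L + (j * (L + 1 - j))%:R).[- i%:R] = 0.
  move=> qL iq; rewrite (bigD1_seq q) ?iota_uniq ?mem_index_iota //=.
  rewrite hornerD horner_ysub -polyC_natr hornerC natrM.
  have -> : (L + 1)%:R = q%:R + (L + 1 - q)%:R :> rat.
    by rewrite -natrD subnKC //; lia.
  by case: iq => ->; set u := q%:R; set w := (_ - _)%:R;
    rewrite (_ : _ + _ = 0) ?mul0r //; ring.
case: (leqP i (L %/ 2)) => iL2; first by rewrite (factor0 i) ?mulr0 //; left.
case: (leqP (L + 1 - i) (L %/ 2)) => iL3.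
  by rewrite (factor0 (L + 1 - i)%N) ?mulr0 //; right; lia.
have -> : (L %% 2 = 1)%N by lia.
have -> : (L + 1 = i + i)%N by lia.
rewrite exprD expr1 (_ : _ + (i + i)%:R = 0) ?mul0r //.
by rewrite natrD; ring.
Qed.

(** * The determinant formula *)

Theorem theorem3 (L k : nat) (hk : (0 < k)%N) :
  let A := (L %% 2 + (k + 1) %% 2)%N in
  let m := (L + 3 - k %% 2)%N in
  let n := ((k + 1) %/ 2)%N in
  let y : {poly rat} := ysub L in
  let J : 'M[{poly rat}]_n := Jmx n in
  let P : 'M[{poly rat}]_n := Pmx n in
  let D : 'M[{poly rat}]_n := Dmx m n in
  hypersum_poly L k =
    (k`!%:R / (L + k + 1)`!%:R : rat)%:P
    * (((2 ^+ (k - 1) * (1 + L %% 2)%:R : rat)^-1)%:P * sqrtsub L ^+ A)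
    * (\prod_(0 <= q < (L %/ 2).+1) (y + (q * (L + 1 - q))%:R))
    * \det ((1 - (4 * y + (L + 1)%:R ^+ 2) *: J)
            * (\prod_(0 <= q < (L %/ 2).+1)
                 (1 - (L + 1 - 2 * q)%:R ^+ 2 *: J))
            * (D * P ^+ (L + 1) * invmx D)
            - Kmx n 0 + Kmx n (n - 1)).
Proof.
move=> A m n y J P D.
have [n0 n0E] : {n0 | n = n0.+1} by exists n.-1; rewrite prednK // /n; lia.
have sE : size (squares L) = (L %/ 2).+1 by rewrite size_map size_iota subn0.
have sm : (2 * size (squares L) <= m)%N by rewrite sE /m; lia.
have mH : (m <= L.+3)%N by rewrite /m; lia.
have AE : (m - 2 * size (squares L) = A)%N by rewrite sE /m /A; lia.
(* The last divided power has exponent L+k+1, since 2n = k + (k mod 2). This is the source of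
   (L+k+1)!. *)
have mnE : (m + 2 * n0 = k.-1 + L.+2)%N.
  by move: n0E; rewrite /m /n; lia.
set dt := \det _.
(* H = L+2 derivatives are taken: L+1 from the differences and one to remove the constant. *)
have [t tE tH] : exists2 t : {poly rat},
   sqrtsub L ^+ A * (\prod_(c <- squares L) (sqrtsub L ^+ 2 - c%:P)) * dt =
     (L + k + 1)`!%:R *: t &
   iter L.+1 (@sinhc rat) t^`(L.+2) =
     (divpow (sqrtsub L) (k.-1 + L.+2))^`(L.+2).
  have := det_hypersum_mx L.+1 n0E (deriv_sqrtsub L) (size_sqrtsub L) sm mH.
  rewrite AE mnE (_ : k.-1 + L.+2 = L + k + 1)%N; last by lia.
  suff -> : dt = \det
       ((1 - sqrtsub L ^+ 2 *: Jmx n)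
        * \prod_(c <- squares L) (1 - c%:P *: Jmx n)
        * (Dmx m n * Pmx n ^+ L.+1 * invmx (Dmx m n))
        - Kmx n 0 + Kmx n (n - 1)) by [].
  rewrite /dt /D /P /J /y -sqrtsub_sqr /squares big_map !(addn1 L).
  under [in RHS]eq_bigr => q _ do rewrite polyC_exp polyC_natr.
  by [].
set rhs := RHS.
have rhsE : rhs = (k`!%:R / 2 ^+ (L + k + 1)) *: t.
  have fE : (L + k + 1)`!%:R != 0 :> rat by rewrite pnatr_eq0 -lt0n fact_gt0.
  have tE' : t = ((L + k + 1)`!%:R^-1)%:P *
     (sqrtsub L ^+ A * (\prod_(c <- squares L) (sqrtsub L ^+ 2 - c%:P)) * dt).
    by rewrite tE mul_polyC scalerA mulVf ?scale1r.
  rewrite tE' /rhs prod_ysub_shift -mul_polyC.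
  (* The powers of 2 add up: (k-1) + (L mod 2) + 2(floor(L/2) + 1) = L+k+1. *)
  have -> : k`!%:R / 2 ^+ (L + k + 1) =
     k`!%:R * (2 ^+ (k - 1) * (1 + L %% 2)%:R)^-1 * 4^-1 ^+ (L %/ 2).+1 :> rat.
    rewrite -mulrA; congr (_ * _); rewrite invfM.
    have -> : (1 + L %% 2)%:R = 2 ^+ (L %% 2) :> rat.
      by case: (L %% 2)%N (ltn_pmod L (isT : 0 < 2)%N) => [|[|]].
    have -> : 4^-1 = 2^-1 ^+ 2 :> rat by [].
    by rewrite -exprM -!exprVn -!exprD; congr (_ ^+ _); lia.
  rewrite !polyCM; ring.
apply/eqP; rewrite -subr_eq0 rhsE; apply/eqP.
apply: (@iter_bdiff_inj0 _ L.+1) => [i iL|].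
  rewrite hornerD hornerN -rhsE hypersum_poly_root // sub0r; apply/eqP.
  rewrite oppr_eq0; apply/eqP.
  have := sqrtsub_prod_ysub_root0 k iL; rewrite hornerM => r0.
  rewrite /rhs !hornerM.
  by rewrite -[X in X * _]mulrA -[X in _ * X * _]mulrA r0 !mulr0 mul0r.
(* Both sides now reduce to k N^(k-1). The translation by (L+1)/2 turns x into 2N, and the factors
   2^(L+2) and 2^(k-1) cancel 2^(L+k+1). *)
rewrite iter_bdiffBZ iter_bdiff_hypersum_poly derivB derivZ.
rewrite deriv_iter_bdiff tH derivn_divpow ?deriv_sqrtsub // derivXn.
rewrite /divpow !comp_polyZ rmorphXn /= comp_sqrtsub.
rewrite exprMn -polyC_exp mul_polyC !scalerA -scaler_nat -scalerBl.
rewrite [X in X *: _](_ : _ = 0) ?scale0r //.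
have -> : (L + k + 1 = k.-1 + L.+2)%N by lia.
rewrite -(prednK hk) factS natrM exprD /=.
have f0 : k.-1`!%:R != 0 :> rat by rewrite pnatr_eq0 -lt0n fact_gt0.
have p0 j : 2 ^+ j != 0 :> rat by rewrite expf_neq0.
have a0 := p0 k.-1; have b0 := p0 L.+2.
move: (2 ^+ k.-1) (2 ^+ L.+2) (k.-1)`!%:R k.-1.+1%:R a0 b0 f0.
move=> a b f c a0 b0 f0.
by field; rewrite a0 b0 f0.
Qed.
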